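(* For every $\epsilon>0$ there exist an integer $k>0$ and a constant $c>0$, both depending only on $\epsilon$, such that for every finite set $A\subset\mathbb{R}$, $$|(A-A)^{(k)}| \ \ge\ c\,|A|^{3-\epsilon}.$$
   Context: $A-A=\{a-b:a,b\in A\}$. For a set $X\subset\mathbb{R}$, $X^{(k)}=\{x_1x_2\cdots x_k: x_1,\dots,x_k\in X\}$ denotes the $k$-fold product set. *)

(* Defs.v *)
From HB Require Import structures.
From mathcomp Require Import all_boot all_order all_algebra.
From mathcomp Require Import finmap.
From mathcomp Require Import reals exp.

Set Implicit Arguments.
Unset Strict Implicit.
Unset Printing Implicit Defensive.

Import Order.TTheory GRing.Theory Num.Theory.
Local Open Scope fset_scope.
Local Open Scope ring_scope.

Definition diffset (R : realType) (A : {fset R}) : {fset R} :=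
  [fset a - b | a in A, b in A].

Definition prodset (R : realType) (k : nat) (X : {fset R}) : {fset R} :=
  [fset \prod_(i < k) val (x i) | x : {ffun 'I_k -> X} in predT].

(* Main.v *)
Require Import Defs.
From HB Require Import structures.
From mathcomp Require Import all_boot all_order all_algebra.
From mathcomp Require Import finmap.
From mathcomp Require Import reals exp.
From mathcomp Require Import zify ring lra.

Set Implicit Arguments.
Unset Strict Implicit.
Unset Printing Implicit Defensive.

Import Order.TTheory GRing.Theory Num.Theory.
Local Open Scope fset_scope.
Local Open Scope ring_scope.

(** Let D be the set of nonzero differences of A, n = #|A|, and D^(k) its k-fold
    product set. The quantity |D^(k)| cannot be multiplied by more than n^d at
    each step k -> 2k+1 without exceeding n^3 after boundedly many steps, so for
    some bounded k the set P = D^(k) is almost closed under multiplication by D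
    (slow_step_or_geometric), and by the Ruzsa triangle inequality
    (ruzsa_triangle) the set Y = D^(k+1) / D is not much larger than P.

    For distinct a, b, c in A the ratio u = (a-b)/(a-c) satisfies
    1 - u = (b-c)/(a-c). So each such u gives a solution of the equation
    u + u' = 1 with P u and P u' both contained in Y. Every such solution is
    visible on all of the lines x/p + y/q = 1 with p, q in P, as the point
    (p u, q u') of the grid Y x Y. The Szemeredi-Trotter bound for these |P|^2
    lines limits the number N of ratios u by N^3 << |Y|^4 / |P|^2, that is,
    essentially by |P|^2 (card_unit_equation).

    On the other hand N is at least n^2 up to a logarithm
    (card_pinned_ratios): two triples with equal ratio are three collinear points
    of A x A, and Szemeredi-Trotter bounds the number of collinear triples by
    n^4 log n; Cauchy-Schwarz concludes. Comparing the two bounds,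
    |P|^2 >> n^6 up to small powers of n.

    Both uses of Szemeredi-Trotter concern Cartesian products, where an
    elementary partition into cells suffices (grid_incidences). *)

(** * Lines and Cartesian products *)

Local Open Scope nat_scope.

Lemma sum_nat_bool (I : finType) (P : pred I) : \sum_i (P i : nat) = #|[set i | P i]|.
Proof.
rewrite cardsE -sum1_card [RHS]big_mkcond /=; apply: eq_bigr => i _.
by rewrite unfold_in; case: (P i).
Qed.

(** Along a chain for the product order the sum of the two coordinates is
    injective, so a monotone curve meets few of the C^2 cells. *)
Lemma card_monotone_cells (C : nat) (S : {set 'I_C * 'I_C}) :
  (forall p q, p \in S -> q \in S -> p.1 < q.1 -> p.2 <= q.2) ->
  #|S| <= 2 * C.
Proof.
move=> chain.
have bnd (p : 'I_C * 'I_C) : p.1 + p.2 < 2 * C by have := ltn_ord p.1; have := ltn_ord p.2; lia.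
pose f p := Ordinal (bnd p).
rewrite -[2 * C]card_ord -(@card_in_imset _ _ f S) ?max_card //.
move=> [i j] [i' j'] pS qS /(congr1 val) /= e.
have := chain _ _ pS qS; have := chain _ _ qS pS => /= h1 h2.
have ei : i = i' :> nat.
  by move: h1 h2; case: (ssrnat.ltngtP i i') => [lt _ /(_ isT)|lt /(_ isT) + _|//]; lia.
by congr (_, _); apply: val_inj => //=; lia.
Qed.

Lemma card_antitone_cells (C : nat) (S : {set 'I_C * 'I_C}) :
  (forall p q, p \in S -> q \in S -> p.1 < q.1 -> q.2 <= p.2) ->
  #|S| <= 2 * C.
Proof.
move=> chain.
pose f (p : 'I_C * 'I_C) := (p.1, rev_ord p.2).
have finj : injective f.
  move=> [i j] [i' j'] e.
  by congr (_, _); [exact: (congr1 fst e) | exact: rev_ord_inj (congr1 snd e)].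
rewrite -(card_imset _ finj); apply: card_monotone_cells.
move=> _ _ /imsetP[p pS ->] /imsetP[q qS ->] /= pq.
exact/leq_sub2l/(chain _ _ pS qS pq).
Qed.

(** Every point of S which is not the chosen representative of its fibre forms a
    pair with that representative. *)
Lemma card_le_fibers (P K : finType) (c : P -> K) (S : {set P}) :
  #|S| - #|c @: S| <= #|[set pq : P * P | [&& pq.1 \in S, pq.2 \in S,
                                              pq.1 != pq.2 & c pq.1 == c pq.2]]|.
Proof.
rewrite leq_subLR.
pose rep p := odflt p [pick q in S | c q == c p].
have repP p : p \in S -> (rep p \in S) && (c (rep p) == c p).
  by move=> pS; rewrite /rep; case: pickP => [q //|/(_ p)]; rewrite pS eqxx.
have rep_eq p q : p \in S -> q \in S -> c p = c q -> rep p = rep q.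
  move=> pS qS e; rewrite /rep e; case: pickP => [//|/(_ p)].
  by rewrite pS e eqxx.
set S0 := [set p in S | rep p == p].
have /eqP <- : #|S0| + #|S :\: S0| == #|S|.
  by rewrite -(cardsID S0 S) (setIidPr _) //; apply/subsetP => p; rewrite inE => /andP[].
apply: leq_add.
  rewrite -(@card_in_imset _ _ c S0) ?subset_leq_card //.
    by apply: imsetS; apply/subsetP => p; rewrite inE => /andP[].
  move=> p q; rewrite !inE => /andP[pS /eqP <-] /andP[qS /eqP <-].
  have /andP[_ /eqP ->] := repP _ pS; have /andP[_ /eqP ->] := repP _ qS.
  exact: rep_eq.
rewrite -(@card_imset _ _ (fun p => (p, rep p))); last by move=> p q [].
apply: subset_leq_card; apply/subsetP => _ /imsetP[p + ->].
rewrite !inE /= => /andP[]; rewrite negb_and => + pS; rewrite pS /= eq_sym => ->.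
by have /andP[-> /eqP ->] := repP _ pS; rewrite eqxx.
Qed.

(** Ranks replace the real values by integers, so that blocks of
    consecutive values with a prescribed size are given by integer division. *)
Definition rank (R : realFieldType) (T : finType) (v : T -> R) (x : T) :=
  #|[set y | (v y < v x)%R]|.

Lemma rank_lt (R : realFieldType) (T : finType) (v : T -> R) x :
  rank v x < #|T|.
Proof.
rewrite -cardsT; apply: proper_card; apply/properP; split; first exact: subsetT.
by exists x; rewrite !inE // ltxx.
Qed.

Lemma rank_homo (R : realFieldType) (T : finType) (v : T -> R) x y :
  (v x <= v y)%R -> rank v x <= rank v y.
Proof.
by move=> xy; apply: subset_leq_card; apply/subsetP => z; rewrite !inE => /lt_le_trans; apply.
Qed.

Lemma rank_mono (R : realFieldType) (T : finType) (v : T -> R) x y :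
  (v x < v y)%R -> rank v x < rank v y.
Proof.
move=> xy; apply: proper_card; apply/properP; split.
  by apply/subsetP => z; rewrite !inE => /lt_trans; apply.
by exists x; rewrite !inE // ltxx.
Qed.

Lemma rank_inj (R : realFieldType) (T : finType) (v : T -> R) :
  injective v -> injective (rank v).
Proof.
move=> v_inj x y e; apply: v_inj.
by case: (ltgtP (v x) (v y)) => // /rank_mono; rewrite e ltnn.
Qed.

Definition line_points (R : realFieldType) (T : finType) (v : T -> R) (m t : R) :
  {set T * T} := [set p | (v p.2 == m * v p.1 + t)%R].

Lemma card_same_cell (R : realFieldType) (T : finType) (v : T -> R) s x :
  injective v -> 0 < s -> #|[set y | rank v y %/ s == rank v x %/ s]| <= s.
Proof.
move=> v_inj s0; rewrite -[leqRHS]card_ord.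
have bnd y : rank v y %% s < s by rewrite ltn_mod.
rewrite -(@card_in_imset _ _ (fun y => Ordinal (bnd y))) ?max_card //.
move=> y z; rewrite !inE => /eqP ey /eqP ez [e]; apply: (rank_inj v_inj).
by rewrite (divn_eq (rank v y) s) (divn_eq (rank v z) s) ey ez e.
Qed.

(** Szemeredi-Trotter for a Cartesian product and lines that are not parallel to
    an axis. Cut each axis into C blocks of about #|T| / C elements. A line is
    monotone, so it meets at most 2 C of the C^2 cells; any further points of it
    give pairs of points in a common cell, and a pair lies on only one line. The
    total number of pairs inside the cells is about #|T|^4 / C^2. Keeping C as a
    parameter allows both a single optimal choice and an average over all C. *)
Lemma grid_incidences (R : realFieldType) (T : finType) (v : T -> R) (L : finType)
    (m t : L -> R) (C : nat) :
  injective v -> (forall l, m l != 0%R) -> injective (fun l => (m l, t l)) ->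
  0 < C <= #|T| ->
  C ^ 2 * \sum_l (#|line_points v (m l) (t l)| - 2 * C) <= 4 * #|T| ^ 4.
Proof.
move=> v_inj m_neq0 mt_inj /andP[C0 CT].
(* s is the size of a block; rounding up keeps the number of blocks at most C. *)
set n := #|T|; set s := (n %/ C).+1.
have bnd x : rank v x %/ s < C.
  rewrite ltn_divLR //; apply: leq_trans (rank_lt v x) _.
  by rewrite /s; have := divn_eq n C; have := ltn_pmod n C0; rewrite -/n; nia.
pose cell (p : T * T) := (Ordinal (bnd p.1), Ordinal (bnd p.2)).
set S := fun l => line_points v (m l) (t l).
have cells l : #|cell @: S l| <= 2 * C.
  case: (ltgtP 0%R (m l)) => ml; last by have := m_neq0 l; rewrite -ml eqxx.
    apply: card_monotone_cells => _ _ /imsetP[p + ->] /imsetP[q + ->] /=.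
    rewrite !inE => /eqP ep /eqP eq lt; apply/leq_div2r/rank_homo.
    rewrite ep eq lerD2r ler_pM2l // leNgt; apply/negP => /ltW /rank_homo.
    by move=> /(leq_div2r s); lia.
  apply: card_antitone_cells => _ _ /imsetP[p + ->] /imsetP[q + ->] /=.
  rewrite !inE => /eqP ep /eqP eq lt; apply/leq_div2r/rank_homo.
  rewrite ep eq lerD2r ler_nM2l // leNgt; apply/negP => /ltW /rank_homo.
  by move=> /(leq_div2r s); lia.
pose Q l := [set pq : (T * T) * (T * T) | [&& pq.1 \in S l, pq.2 \in S l, pq.1 != pq.2
                                         & cell pq.1 == cell pq.2]].
have step1 : \sum_l (#|S l| - 2 * C) <= \sum_l #|Q l|.
  apply: leq_sum => l _; apply: leq_trans (card_le_fibers cell (S l)).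
  by rewrite leq_sub2l.
have Qdisj l l' pq : pq \in Q l -> pq \in Q l' -> l = l'.
  case: pq => -[x y] [x' y']; rewrite !inE /= xpair_eqE.
  move=> /and4P[/eqP e1 /eqP e2 ne _] /and4P[/eqP e3 /eqP e4 _ _].
  have dx : (v x - v x' != 0)%R.
    rewrite subr_eq0; apply: contraNneq ne => ex.
    rewrite (v_inj _ _ ex) eqxx /=; apply/eqP/v_inj; by rewrite e1 e2 ex.
  have em : m l = m l'.
    apply: (mulIf dx); lra.
  apply: mt_inj; rewrite em; congr pair.
  by move: e1; rewrite e3 em => /addrI.
have step2 : \sum_l #|Q l| <= #|[set pq | cell pq.1 == cell pq.2]|.
  under eq_bigr => l _ do rewrite -sum1_card.
  rewrite (exchange_big_dep (fun pq => cell pq.1 == cell pq.2)) /=; last first.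
    by move=> l pq _; rewrite inE => /and4P[].
  rewrite -sum1_card [leqRHS](eq_bigl (fun pq => cell pq.1 == cell pq.2)); last first.
    by move=> pq; rewrite inE.
  apply: leq_sum => pq _; rewrite sum1_card.
  apply/card_le1_eqP => l l'; rewrite !unfold_in /= => h1 h2.
  exact: Qdisj h2 h1.
have step3 : #|[set pq : (T * T) * (T * T) | cell pq.1 == cell pq.2]| <= n ^ 2 * s ^ 2.
  rewrite -sum_nat_bool -(pair_bigA _ (fun p q => (cell p == cell q : nat))) /=.
  have -> : n ^ 2 * s ^ 2 = \sum_(p : T * T) s ^ 2.
    by rewrite sum_nat_const card_prod -/n mulnn.
  apply: leq_sum => p _; rewrite sum_nat_bool.
  apply: leq_trans (_ : #|setX [set x | rank v x %/ s == rank v p.1 %/ s]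
      [set x | rank v x %/ s == rank v p.2 %/ s]| <= _).
    apply: subset_leq_card; apply/subsetP => q; rewrite !inE /cell => /eqP [-> ->].
    by rewrite !eqxx.
  by rewrite cardsX -mulnn leq_mul ?card_same_cell.
have sC : s * C <= 2 * n by rewrite /s mulSn; have := leq_trunc_div n C; lia.
apply: leq_trans (_ : C ^ 2 * (n ^ 2 * s ^ 2) <= _).
  by rewrite leq_mul2l (leq_trans step1 (leq_trans step2 step3)) orbT.
have : (s * C) ^ 2 <= (2 * n) ^ 2 by rewrite leq_exp2r.
rewrite !expnMn => h.
have -> : 4 * n ^ 4 = n ^ 2 * (2 ^ 2 * n ^ 2) by rewrite (expnD n 2 2); lia.
by rewrite mulnCA leq_mul2l mulnC h orbT.
Qed.

(** * Collinear triples and the number of ratios (a - b) / (a - c) *)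

Lemma sum_weighted_excess m h : 2 * h <= m ->
  6 * \sum_(1 <= C < h.+1) C * (m - 2 * C) + 2 * (h * h.+1 * (2 * h).+1)
  = 3 * m * (h * h.+1).
Proof.
elim: h => [|h IH] hm; first by rewrite big_geq // !muln0.
rewrite big_nat_recr //= mulnDr.
have {}IH := IH ltac:(lia).
have [d e] : exists d, m = 2 * h.+1 + d by exists (m - 2 * h.+1); lia.
move: IH; set S := \sum_(1 <= C < h.+1) _ => IH.
have -> : m - 2 * h.+1 = d by lia.
rewrite e in IH *; nia.
Qed.

(** Summing the truncated excess m - 2C over C with weight C gives a cubic in m.
    This turns the bounds of grid_incidences for all C into a third moment of the
    number of points on a line, without a dyadic decomposition. *)
Lemma ffact3_le_weighted_excess m n : m <= n ->
  m ^_ 3 <= 24 * \sum_(1 <= C < n.+1) C * (m - 2 * C).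
Proof.
move=> mn; set h := m./2.
have mE := odd_double_half m; rewrite -/h -mul2n in mE.
have hm : 2 * h <= m by lia.
rewrite (@big_cat_nat _ _ _ h.+1) //=; last by rewrite ltnS; lia.
apply: leq_trans (_ : 24 * \sum_(1 <= C < h.+1) C * (m - 2 * C) <= _); last first.
  by rewrite leq_mul2l leq_addr orbT.
have := sum_weighted_excess hm; set S := \sum_(1 <= C < h.+1) _ => e.
rewrite !ffactnS ffactn0 muln1.
case: (h) mE e => [|k]; case: (odd m) => /= <- e; [done|done| |].
  have -> : 1 + 2 * k.+1 = (2 * k).+3 by lia.
  move: e => /=; nia.
have -> : 0 + 2 * k.+1 = (2 * k).+2 by lia.
move: e => /=; nia.
Qed.

(** Nested removals, rather than three inequalities, make the count a falling
    factorial step by step. *)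
Definition distinct_triples (P : finType) (S : {set P}) : {set P * P * P} :=
  [set w | [&& w.1.1 \in S, w.1.2 \in S :\ w.1.1 & w.2 \in S :\ w.1.1 :\ w.1.2]].

Lemma card_distinct_triples (P : finType) (S : {set P}) :
  #|distinct_triples S| = #|S| ^_ 3.
Proof.
rewrite -sum_nat_bool -(pair_bigA _ (fun ab c =>
  ([&& ab.1 \in S, ab.2 \in S :\ ab.1 & c \in S :\ ab.1 :\ ab.2] : nat))) /=.
rewrite -(pair_bigA _ (fun a b => \sum_c
  ([&& a \in S, b \in S :\ a & c \in S :\ a :\ b] : nat))) /=.
transitivity (\sum_(a in S) \sum_(b in S :\ a) #|S|.-2).
  rewrite [RHS]big_mkcond; apply: eq_bigr => a _.
  case: ifP => aS; last by rewrite big1 // => b _; rewrite big1.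
  rewrite [RHS]big_mkcond; apply: eq_bigr => b _.
  case: ifP => bS; last by rewrite big1.
  rewrite sum_nat_bool /=.
  rewrite (cardsD1 a S) aS (cardsD1 b (S :\ a)) bS /=.
  by congr #|pred_of_set _|; apply/setP => c; rewrite inE.
under eq_bigr => a aS.
  rewrite sum_nat_const (_ : #|S :\ a| = #|S|.-1); last by rewrite (cardsD1 a S) aS.
over.
by rewrite sum_nat_const !ffactnS ffactn0 muln1.
Qed.

Lemma sqr_sum_le_card_sum_sqr (I : finType) (a : I -> nat) :
  (\sum_i a i) ^ 2 <= #|I| * \sum_i a i ^ 2.
Proof.
rewrite -(leq_pmul2l (isT : 0 < 2)).
have -> : 2 * (\sum_i a i) ^ 2 = \sum_i \sum_j 2 * (a i * a j).
  rewrite -mulnn big_distrlr /= big_distrr /=; apply: eq_bigr => i _.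
  by rewrite big_distrr.
have -> : 2 * (#|I| * \sum_i a i ^ 2) = \sum_i \sum_j (a i ^ 2 + a j ^ 2).
  under [RHS]eq_bigr => i _ do rewrite big_split /= sum_nat_const.
  by rewrite big_split /= sum_nat_const -big_distrr /= mul2n addnn.
apply: leq_sum => i _; apply: leq_sum => j _; exact: nat_Cauchy.
Qed.

Local Open Scope fset_scope.
Local Open Scope ring_scope.

Definition pinned_ratio (R : realFieldType) (T : finType) (v : T -> R) (w : T * T * T) : R :=
  (v w.1.1 - v w.1.2) / (v w.1.1 - v w.2).

(** The weight C against the factor 1 / C^2 of grid_incidences leaves a harmonic
    sum, which is the logarithm in the bound for collinear triples. *)
Lemma sum_collinear_triples (R : realFieldType) (T : finType) (v : T -> R) (L : finType)
    (m t : L -> R) :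
  injective v -> (forall l, m l != 0) -> injective (fun l => (m l, t l)) ->
  (\sum_l #|line_points v (m l) (t l)| ^_ 3)%:R
    <= 96 * #|T|%:R ^+ 4 * \sum_(1 <= C < #|T|.+1) C%:R^-1 :> R.
Proof.
move=> v_inj m0 mt_inj; set n := #|T|.
have pts_le l : (#|line_points v (m l) (t l)| <= n)%N.
  rewrite -(@card_in_imset _ _ fst) ?max_card // => -[x y] [x' y']; rewrite !inE /=.
  by move=> /eqP e /eqP e' xx; congr (_, _) => //; apply: v_inj; rewrite e e' xx.
apply: le_trans (_ : (24 * \sum_(1 <= C < n.+1) C * \sum_l
  (#|line_points v (m l) (t l)| - 2 * C))%N%:R <= _).
  rewrite ler_nat; under [X in (_ <= _ * X)%N]eq_bigr => C _ do rewrite big_distrr /=.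
  rewrite exchange_big /= big_distrr /=.
  by apply: leq_sum => l _; apply: ffact3_le_weighted_excess.
rewrite natrM natr_sum !mulr_sumr [leLHS]big_nat_cond [leRHS]big_nat_cond.
apply: ler_sum => C; rewrite andbT ltnS => /andP[C0 Cn].
have Cp : 0 < C%:R :> R by rewrite ltr0n.
rewrite ler_pdivlMr //.
have := @grid_incidences R T v L m t C v_inj m0 mt_inj; rewrite C0 => /(_ Cn).
rewrite -/n; set S := (\sum_l _)%N => h.
rewrite -(ler_nat R) !natrM in h; rewrite natrM; lra.
Qed.

(** If (a-b)/(a-c) = (a'-b')/(a'-c') then (a,a'), (b,b') and (c,c') lie on one
    line, whose slope (a'-b')/(a-b) is finite and nonzero. *)
Lemma pinned_ratio_energy (R : realFieldType) (T : finType) (v : T -> R) :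
  injective v -> exists (L : finType) (m t : L -> R),
    [/\ forall l, m l != 0, injective (fun l => (m l, t l)) &
     (#|[set w : (T * T * T) * (T * T * T) | [&& w.1 \in distinct_triples setT,
       w.2 \in distinct_triples setT & pinned_ratio v w.1 == pinned_ratio v w.2]]|
      <= \sum_l #|line_points v (m l) (t l)| ^_ 3)%N].
Proof.
move=> v_inj.
pose slope (w : (T * T) * (T * T)) :=
  (v w.2.1 - v w.2.2) / (v w.1.1 - v w.1.2).
pose icpt (w : (T * T) * (T * T)) := v w.2.1 - slope w * v w.1.1.
pose L := [fset (slope w, icpt w) | w in [pred w | slope w != 0]]%fset.
exists L, (fun l => (val l).1), (fun l => (val l).2); split.
- by case=> -[m t] /= /imfsetP[w /= w0 [-> _]].
- by move=> l l' e; apply: val_inj; case: (val l) (val l') e => [? ?] [? ?].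
set W := [set w | _].
(* A pair of triples is read as a triple of points of the plane. *)
pose phi (w : (T * T * T) * (T * T * T)) :=
  ((w.1.1.1, w.2.1.1), (w.1.1.2, w.2.1.2), (w.1.2, w.2.2)).
have phi_inj : injective phi.
  by move=> [[[a b] c] [[a' b'] c']] [[[d e] f] [[d' e'] f']] [-> -> -> -> -> ->].
under eq_bigr => l _ do rewrite -card_distinct_triples -sum1_card.
rewrite -(card_imset _ phi_inj) -sum1_card.
rewrite (exchange_big_dep predT) //= [leqLHS]big_mkcond.
apply: leq_sum => p _; case: ifP => // /imsetP[w wW ->].
suff [l hl] : exists l : L, phi w \in distinct_triples (line_points v (val l).1 (val l).2).
  by rewrite (bigD1 l) //= leq_addr.
case: w wW => [[[a b] c] [[a' b'] c']]; rewrite !inE /= !andbT /pinned_ratio /=.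
move=> /and3P[/and3P[ba cb ca] /and3P[b'a' c'b' c'a'] /eqP e].
have dv x y : x != y -> v y - v x != 0.
  by move=> xy; rewrite subr_eq0; apply: contraNneq xy => /v_inj ->.
pose q := ((a, b), (a', b')).
have q0 : slope q != 0 by rewrite mulf_neq0 ?invr_neq0 ?dv.
have qL : (slope q, icpt q) \in L by apply/imfsetP; exists q.
exists [` qL]%fset; rewrite !inE /= !xpair_eqE.
have sE : v a' - v b' = slope q * (v a - v b) by rewrite /slope /= divfK ?dv.
have sE' : v a' - v c' = slope q * (v a - v c).
  move: e; rewrite sE => /eqP; rewrite eqr_div ?dv // => /eqP e.
  have := dv _ _ ba => d; apply: (mulIf d); rewrite mulrC e; ring.
have iE : icpt q = v a' - slope q * v a by [].
rewrite (negbTE ba) (negbTE cb) (negbTE ca) /= iE.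
by apply/and3P; split; apply/eqP; lra.
Qed.

(** Cauchy-Schwarz applied to the number of triples with a given ratio. *)
Lemma card_pinned_ratios (R : realFieldType) (T : finType) (v : T -> R) (U : {fset R}) :
  injective v ->
  (forall w, w \in distinct_triples [set: T] -> pinned_ratio v w \in U) ->
  (#|T| ^_ 3)%:R ^+ 2
    <= #|` U|%:R * (96 * #|T|%:R ^+ 4 * \sum_(1 <= C < #|T|.+1) C%:R^-1) :> R.
Proof.
move=> v_inj hU.
have [L [m [t [m0 mt_inj hW]]]] := pinned_ratio_energy v_inj.
apply: le_trans (_ : #|` U|%:R * (\sum_l #|line_points v (m l) (t l)| ^_ 3)%:R <= _); last first.
  by rewrite ler_wpM2l // sum_collinear_triples.
rewrite -natrX -natrM ler_nat; set W := [set w | _] in hW.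
apply: leq_trans (leq_mul (leqnn _) hW).
pose F (u : U) := [set w in distinct_triples [set: T] | pinned_ratio v w == val u].
have -> : (#|T| ^_ 3 = \sum_u #|F u|)%N.
  rewrite -cardsT -card_distinct_triples -sum1_card.
  under [RHS]eq_bigr => u _ do rewrite -sum1_card.
  rewrite [RHS](exchange_big_dep (mem (distinct_triples [set: T]))) /=; last first.
    by move=> u w _; rewrite inE => /andP[].
  apply: eq_bigr => w wT; rewrite (big_pred1 [` hU _ wT]%fset) // => u.
  by rewrite /= inE wT /= eq_sym -val_eqE.
apply: leq_trans (sqr_sum_le_card_sum_sqr _) _; rewrite -cardfE leq_mul2l; apply/orP; right.
under eq_bigr => u _ do rewrite -mulnn -cardsX -sum1_card.
rewrite (exchange_big_dep (mem W)) /=; last first.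
  move=> u [p q] _; rewrite !inE /= => /andP[/andP[-> /eqP ->] /andP[-> /eqP ->]].
  by rewrite eqxx.
rewrite -sum1_card; apply: leq_sum => -[p q] _; rewrite sum1_card.
apply/card_le1_eqP => u u' pu pu'.
have ratioE z : (p, q) \in setX (F z) (F z) -> val z = pinned_ratio v p.
  by rewrite !inE => /andP[/andP[_ /eqP ->]].
by apply: val_inj; rewrite (ratioE u pu) (ratioE u' pu').
Qed.

(** By induction, as ln (n+1) = ln (n+2) + ln (1 - 1/(n+2)) and ln (1 + x) <= x. *)
Lemma harmonic_le_ln (R : realType) n : (0 < n)%N ->
  \sum_(1 <= C < n.+1) C%:R^-1 <= 1 + ln n%:R :> R.
Proof.
elim: n => // -[_ _|n IH _]; first by rewrite big_nat1 ln1 addr0 invr1.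
rewrite big_nat_recr //=; apply: le_trans (lerD (IH isT) (lexx _)) _.
rewrite -addrA lerD2l.
have n1 : 0 < n.+1%:R :> R by rewrite ltr0n.
have n2 : 0 < n.+2%:R :> R by rewrite ltr0n.
have -> : n.+1%:R = n.+2%:R * (1 + - n.+2%:R^-1) :> R.
  by rewrite mulrDr mulr1 mulrN divff ?gt_eqF // -(natr1 n.+1) addrK.
have lt1 : n.+2%:R^-1 < 1 :> R by rewrite invf_lt1 // ltr1n.
rewrite lnM ?posrE //; last by rewrite subr_gt0.
have := @le_ln1Dx R (- n.+2%:R^-1); rewrite ltrN2 => /(_ lt1) h.
by rewrite -addrA gerDl -lerBrDr sub0r.
Qed.

(** From ln x <= x - 1 at x = n^d, which gives d ln n <= n^d. *)
Lemma harmonic_le_powR (R : realType) (d : R) n : 0 < d -> (0 < n)%N ->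
  \sum_(1 <= C < n.+1) C%:R^-1 <= (1 + d^-1) * n%:R `^ d :> R.
Proof.
move=> d0 n0; apply: le_trans (harmonic_le_ln _ n0) _.
have n1 : 1 <= n%:R :> R by rewrite ler1n.
have p1 : 1 <= n%:R `^ d by have := ler_powR n1 (ltW d0); rewrite powRr0.
have := @le_ln1Dx R (n%:R `^ d - 1); rewrite [1 + _]addrC subrK ln_powR => h.
have {}h : d * ln n%:R <= n%:R `^ d by have := h ltac:(lra); lra.
by rewrite mulrDl mul1r lerD // mulrC ler_pdivlMr // mulrC.
Qed.

(** * The equation u + u' = 1 in sets with small multiplicative growth *)

Lemma leq_card_fset_in (K K' : choiceType) (f : K -> K') (X : {fset K}) (Y : {fset K'}) :
  {in X &, injective f} -> (forall x, x \in X -> f x \in Y) -> (#|` X| <= #|` Y|)%N.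
Proof.
move=> f_inj XY.
have <- : #|` [fset f x | x in X]| = #|` X| by apply: card_in_imfset.
by apply/fsubset_leq_card/fsubsetP => _ /imfsetP[x /= xX ->]; apply: XY.
Qed.

Lemma card_fsetM (K K' : choiceType) (A : {fset K}) (B : {fset K'}) :
  #|` A `*` B| = (#|` A| * #|` B|)%N.
Proof.
rewrite -(size_allpairs pair A B); apply/perm_size/uniq_perm => //.
  by apply: allpairs_uniq => // -[a b] [a' b'].
move=> [a b]; rewrite in_fsetM /=; apply/idP/allpairsP => [/andP[aA bB]|].
  by exists (a, b).
by move=> [[a' b'] /= [aA bB [-> ->]]]; rewrite aA.
Qed.

(** For a, b in X the points (a u, b (1 - u)), with u in U, lie on the line
    x/a + y/b = 1, so each of the #|X|^2 lines contains #|U| points of Y x Y. With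
    about #|U| / 4 blocks on each axis, half of these points count as excess in
    grid_incidences. *)
Lemma card_unit_equation (R : realFieldType) (X Y U : {fset R}) :
  0 \notin X -> 0 \notin U ->
  (forall a u, a \in X -> u \in U -> (a * u \in Y) && (a * (1 - u) \in Y)) ->
  (#|` X| ^ 2 * #|` U| ^ 3 <= 512 * #|` Y| ^ 4)%N.
Proof.
move=> X0 U0 XUY.
have nzX a : a \in X -> a != 0 by move=> aX; apply: contraNneq X0 => <-.
have nzU u : u \in U -> u != 0 by move=> uU; apply: contraNneq U0 => <-.
have [->|[a0 a0X]] := fset_0Vmem X; first by rewrite cardfs0.
have [->|[u0 u0U]] := fset_0Vmem U; first by rewrite cardfs0 muln0.
have UY : (#|` U| <= #|` Y|)%N.
  apply: (@leq_card_fset_in _ _ ( *%R a0)) => [u u' _ _|u uU].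
    exact/mulfI/nzX.
  by have /andP[] := XUY _ _ a0X uU.
have XY : (#|` X| <= #|` Y|)%N.
  apply: (@leq_card_fset_in _ _ ( *%R^~ u0)) => [a a' _ _|a aX].
    exact/mulIf/nzU.
  by have /andP[] := XUY _ _ aX u0U.
set x := #|` X| in XY *; set y := #|` Y| in UY XY *; set N := #|` U| in UY *.
(* Below four points the number N / 4 of blocks vanishes; there #|X| <= #|Y| is
   enough. *)
have [N4|N4] := ltnP N 4.
  have Y2 : (y ^ 2 <= y ^ 4)%N by case: (y) => // z; rewrite leq_pexp2l.
  have N3 : (N ^ 3 <= 3 ^ 3)%N by rewrite leq_exp2r.
  have X2 : (x ^ 2 <= y ^ 2)%N by rewrite leq_exp2r.
  rewrite [leqRHS]mulnC; apply: leq_mul; first exact: leq_trans X2 Y2.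
  exact: leq_trans N3 _.
pose m (l : X * X) := - (val l.2 / val l.1).
pose t (l : X * X) := val l.2.
have m0 l : m l != 0 by rewrite oppr_eq0 mulf_neq0 ?invr_neq0 ?nzX ?fsvalP.
have mt_inj : injective (fun l => (m l, t l)).
  move=> [a b] [a' b'] [/oppr_inj /= + eb]; rewrite /t /= in eb.
  rewrite eb => /(mulfI (nzX _ (fsvalP b'))) /invr_inj ea.
  by congr (_, _); apply: val_inj.
have pts l : (N <= #|line_points (val : Y -> R) (m l) (t l)|)%N.
  case: l => a b; rewrite /N cardfE.
  (* The default value of insubd is any element of Y; it is never taken. *)
  pose f (u : U) : Y * Y := (insubd [` proj1 (andP (XUY _ _ a0X u0U))] (val a * val u),
                       insubd [` proj1 (andP (XUY _ _ a0X u0U))] (val b * (1 - val u))).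
  have fE u : val (f u).1 = val a * val u /\ val (f u).2 = val b * (1 - val u).
    have /andP[h _] := XUY _ _ (fsvalP a) (fsvalP u).
    have /andP[_ h'] := XUY _ _ (fsvalP b) (fsvalP u).
    by rewrite /f /= !val_insubd h h'.
  rewrite -cardsT -(@card_imset _ _ f); last first.
    move=> u u' e; apply/val_inj/(mulfI (nzX _ (fsvalP a))).
    by rewrite -(proj1 (fE u)) -(proj1 (fE u')) e.
  apply: subset_leq_card; apply/subsetP => _ /imsetP[u _ ->]; rewrite inE.
  have [-> ->] := fE u; apply/eqP; rewrite /m /t /=.
  by field; apply: nzX; apply: fsvalP.
set C := (N %/ 4)%N.
have C0 : (0 < C)%N by rewrite divn_gt0.
have CN : (C <= N)%N by exact: leq_div.
have NC : (N <= 8 * C)%N by rewrite /C; lia.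
have := grid_incidences val_inj m0 mt_inj (_ : 0 < C <= #|{: Y}|)%N.
rewrite -cardfE C0 (leq_trans CN UY) => /(_ isT); rewrite -/y => h.
have low : (x ^ 2 * (N - 2 * C) <= \sum_l (#|line_points (val : Y -> R) (m l) (t l)| - 2 * C))%N.
  have -> : (x ^ 2 = #|{: X * X}|)%N by rewrite card_prod -cardfE -mulnn.
  by rewrite -sum_nat_const; apply: leq_sum => l _; rewrite leq_sub2r.
have half : (N <= 2 * (N - 2 * C))%N by rewrite /C; lia.
have C2 : (N ^ 2 <= 64 * C ^ 2)%N by rewrite -[64%N]/(8 ^ 2)%N -expnMn leq_exp2r.
apply: leq_trans (_ : x ^ 2 * (64 * C ^ 2 * (2 * (N - 2 * C))) <= _)%N.
  by rewrite leq_mul2l (expnSr N 2) (leq_mul C2 half) orbT.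
apply: leq_trans (_ : 128 * (C ^ 2 * (x ^ 2 * (N - 2 * C))) <= _)%N; first lia.
have : (C ^ 2 * (x ^ 2 * (N - 2 * C)) <= 4 * y ^ 4)%N.
  by apply: leq_trans h; rewrite leq_mul2l low orbT.
lia.
Qed.

(** * Product sets *)

Lemma prodsetP (R : realType) (k : nat) (X : {fset R}) (x : R) :
  reflect (exists2 f : 'I_k -> R, (forall i, f i \in X) & x = \prod_(i < k) f i)
          (x \in prodset k X).
Proof.
rewrite /prodset; apply: (iffP idP) => [/imfsetP[f _ ->]|[f fX ->]].
  by exists (fun i => val (f i)) => // i; apply: fsvalP.
apply/imfsetP; exists [ffun i => [` fX i]] => //.
by apply: eq_bigr => i _; rewrite ffunE.
Qed.

Lemma mem_prodset1 (R : realType) (X : {fset R}) (x : R) :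
  x \in X -> x \in prodset 1 X.
Proof. by move=> xX; apply/prodsetP; exists (fun=> x) => //; rewrite big_ord1. Qed.

Lemma prodsetM (R : realType) (j k : nat) (X : {fset R}) (x y : R) :
  x \in prodset j X -> y \in prodset k X -> x * y \in prodset (j + k) X.
Proof.
move=> /prodsetP[f fX ->] /prodsetP[g gX ->]; apply/prodsetP.
exists (fun i => match split i with inl a => f a | inr b => g b end).
  by move=> i; case: (split i).
rewrite big_split_ord /=; congr (_ * _); apply: eq_bigr => i _.
  by rewrite -[lshift _ _]/(unsplit (inl i)) unsplitK.
by rewrite -[rshift _ _]/(unsplit (inr i)) unsplitK.
Qed.

Lemma prodsetS (R : realType) (k : nat) (X Z : {fset R}) :
  X `<=` Z -> prodset k X `<=` prodset k Z.
Proof.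
move=> /fsubsetP XZ; apply/fsubsetP => x /prodsetP[f fX ->].
by apply/prodsetP; exists f => // i; apply: XZ.
Qed.

Lemma prodset_notin0 (R : realType) (k : nat) (E : {fset R}) :
  0 \notin E -> 0 \notin prodset k E.
Proof.
move=> E0; apply/negP => /prodsetP[f fE] /esym/eqP/prodf_eq0[i _ /eqP fi].
by case/negP: E0; rewrite -fi.
Qed.

Lemma prodset_exp (R : realType) (k : nat) (E : {fset R}) (d : R) :
  d \in E -> d ^+ k \in prodset k E.
Proof.
by move=> dE; apply/prodsetP; exists (fun=> d) => //; rewrite prodr_const card_ord.
Qed.

Lemma card_prodset_gt0 (R : realType) (k : nat) (E : {fset R}) (d : R) :
  d \in E -> (0 < #|` prodset k E|)%N.
Proof. by move=> dE; rewrite cardfs_gt0; apply/fset0Pn; exists (d ^+ k); apply: prodset_exp. Qed.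

Lemma leq_card_prodset (R : realType) (j k : nat) (E : {fset R}) (d : R) :
  d != 0 -> d \in E -> (j <= k)%N ->
  (#|` prodset j E| <= #|` prodset k E|)%N.
Proof.
move=> d0 dE /subnKC <-; set l := (k - j)%N.
have dl0 : d ^+ l != 0 by rewrite expf_neq0.
apply: (@leq_card_fset_in _ _ ( *%R^~ (d ^+ l))) => [x y _ _|x xP].
  exact: mulIf.
by rewrite prodsetM // prodset_exp.
Qed.

(** Ruzsa's argument: fix a representation y = q / d of every quotient. Then
    (p, y) is recovered from (q p, d p), since the ratio of the two entries is y,
    which determines d and hence p. *)
Lemma ruzsa_triangle (R : realType) (P Q D S T : {fset R}) :
  0 \notin P -> 0 \notin D ->
  (forall p q, p \in P -> q \in Q -> q * p \in S) ->
  (forall p d, p \in P -> d \in D -> d * p \in T) ->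
  (#|` P| * #|` [fset q / d | q in Q, d in D]| <= #|` S| * #|` T|)%N.
Proof.
move=> P0 D0 QP DP; set Y := [fset _ | _ in _, _ in _].
have nzP p : p \in P -> p != 0 by move=> pP; apply: contraNneq P0 => <-.
have nzD d : d \in D -> d != 0 by move=> dD; apply: contraNneq D0 => <-.
pose rep (y : R) : R * R := odflt (0, 0)
  (omap (fun w : Q * D => (val w.1, val w.2)) [pick w : Q * D | val w.1 / val w.2 == y]).
have repP y : y \in Y -> [/\ (rep y).1 \in Q, (rep y).2 \in D & (rep y).1 / (rep y).2 = y].
  case/imfset2P => q /= qQ [d /= dD ->]; rewrite /rep.
  case: pickP => [[q' d'] /= /eqP e|/(_ ([` qQ], [` dD]))]; last by rewrite eqxx.
  by split.
pose f (w : R * R) := ((rep w.2).1 * w.1, (rep w.2).2 * w.1).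
rewrite -!card_fsetM; apply: (@leq_card_fset_in _ _ f).
  move=> [p y] [p' y']; rewrite !inE /= => /andP[pP yY] /andP[pP' yY'] [e1 e2].
  have [q1 d1 <-] := repP _ yY; have [q2 d2 <-] := repP _ yY'.
  have p0 := nzP _ pP; have p0' := nzP _ pP'.
  have ey : (rep y).1 / (rep y).2 = (rep y').1 / (rep y').2.
    rewrite -(mulfK p0 (rep y).1) -(mulfK p0 (rep y).2) e1 e2.
    by rewrite -!mulf_div !divff // ?mulr1 ?invr_neq0.
  have eyy : y = y'.
    by case: (repP _ yY) (repP _ yY') => _ _ <- [_ _ <-].
  rewrite -eyy in e2 *; congr (_, _).
  exact: (mulfI (nzD _ d1) e2).
move=> [p y]; rewrite !inE /= => /andP[pP /repP[qQ dD _]].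
by rewrite QP // DP.
Qed.

(** * Choosing the number of factors *)

Lemma slow_step_or_geometric (R : realDomainType) (K : R) (f : nat -> R) J :
  0 <= K -> 1 <= f 0%N ->
  (exists2 j, (j < J)%N & f j.+1 <= K * f j) \/ K ^+ J <= f J.
Proof.
move=> K0 f0; elim: J => [|J [[j jJ h]|IH]]; first by right; rewrite expr0.
  by left; exists j => //; apply: ltnW.
have [h|h] := lerP (f J.+1) (K * f J); first by left; exists J.
by right; rewrite exprS; apply: le_trans (ltW h); rewrite ler_wpM2l.
Qed.

Definition nonzero_diffset (R : realType) (A : {fset R}) : {fset R} := diffset A `\ 0.

Lemma sub_nonzero_diffset (R : realType) (A : {fset R}) a b :
  a \in A -> b \in A -> a != b -> a - b \in nonzero_diffset A.
Proof.
by move=> aA bA ab; rewrite !inE subr_eq0 ab; apply/imfset2P; exists a => //; exists b.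
Qed.

Lemma exists_nonzero_diff (R : realType) (A : {fset R}) :
  (1 < #|` A|)%N -> exists e, e \in nonzero_diffset A.
Proof.
rewrite cardfE => /card_gt1P[x [y [_ _ xy]]].
by exists (val x - val y); apply: sub_nonzero_diffset; rewrite ?fsvalP.
Qed.

Definition pinned_ratios (R : realType) (A : {fset R}) : {fset R} :=
  [fset pinned_ratio (val : A -> R) w | w in distinct_triples [set: A]].

(** For n >= 3 the number of triples is at least 2 n^3 / 9, and
    1944 = 96 * (9/2)^2. *)
Lemma card_pinned_ratios_powR (R : realType) (A : {fset R}) (d : R) : 0 < d -> (2 < #|` A|)%N ->
  #|` A|%:R ^+ 2 <= 1944 * (1 + d^-1) * #|` A|%:R `^ d * #|` pinned_ratios A|%:R.
Proof.
move=> d0 n2; set n := #|` A|.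
have n0 : 0 < n%:R :> R by rewrite ltr0n; apply: leq_trans n2.
have inU w : w \in distinct_triples [set: A] -> pinned_ratio (val : A -> R) w \in pinned_ratios A.
  by move=> wT; apply/imfsetP; exists w.
have := card_pinned_ratios val_inj inU.
rewrite -cardfE -/n; set N := #|` pinned_ratios A|%:R => h.
have ff : (2 * n ^ 3 <= 9 * n ^_ 3)%N.
  have [k ->] : exists k, n = k.+3 by exists (n - 3)%N; rewrite -/n in n2; lia.
  rewrite !ffactnS ffactn0 /=; lia.
have {}ff : 2 * n%:R ^+ 3 <= 9 * (n ^_ 3)%:R :> R by rewrite -natrX -!natrM ler_nat.
have Hn := harmonic_le_powR d0 (_ : 0 < n)%N; have {}Hn := Hn (ltnW (ltnW n2)).
set H := \sum_(_ <= _ < _) _ in h Hn; set P := (1 + d^-1) * _ in Hn.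
have {}ff : (2 * n%:R ^+ 3) ^+ 2 <= (9 * (n ^_ 3)%:R) ^+ 2 :> R.
  by rewrite lerXn2r ?nnegrE ?mulr_ge0 ?exprn_ge0 ?ler0n.
have N0 : 0 <= N by rewrite ler0n.
have h' : N * (96 * n%:R ^+ 4 * H) <= N * (96 * n%:R ^+ 4 * P).
  by rewrite ler_wpM2l // ler_wpM2l // mulr_ge0 // exprn_ge0 // ltW.
have : n%:R ^+ 4 * n%:R ^+ 2 <= n%:R ^+ 4 * (1944 * P * N) by lra.
by rewrite ler_pM2l ?exprn_gt0 // /P !mulrA.
Qed.

(** The two bounds #|Y| <= K^2 #|P| and #|P|^2 #|U|^3 <= 512 #|Y|^4 combine, where
    P is the k-fold product set, U the set of ratios and Y the set of quotients
    of k+1 factors by one. The step from k to 2k+1 is what the triangle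
    inequality needs: k factors from P and k+1 from the numerators in Y. *)
Lemma slow_growth_bound (R : realType) (A : {fset R}) k (K : R) :
  (2 < #|` A|)%N -> 0 <= K ->
  #|` prodset (k.*2.+1) (nonzero_diffset A)|%:R
     <= K * #|` prodset k (nonzero_diffset A)|%:R ->
  #|` pinned_ratios A|%:R ^+ 3
     <= 512 * K ^+ 8 * #|` prodset k (nonzero_diffset A)|%:R ^+ 2.
Proof.
move=> n2 K0 slow; set E := nonzero_diffset A in slow *.
set P := prodset k E in slow *; set U := pinned_ratios A.
have E0 : 0 \notin E by rewrite !inE eqxx.
have nzE e : e \in E -> e != 0 by move=> eE; apply: contraNneq E0 => <-.
have [d dE] : exists d, d \in E by exact/exists_nonzero_diff/ltnW.
pose Y := [fset q / e | q in prodset (k + 1) E, e in E].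
have p0 : 0 < #|` P|%:R :> R by rewrite ltr0n; apply: card_prodset_gt0 dE.
have ratioB (a x y z : R) : x - z != 0 -> a * (1 - (x - y) / (x - z)) = a * (y - z) / (x - z).
  by move=> xz; field.
have PUY a u : a \in P -> u \in U -> (a * u \in Y) && (a * (1 - u) \in Y).
  move=> aP /imfsetP[[[x y] z] /=]; rewrite !inE !andbT /= => /and3P[yx zy zx] ->.
  have D (b c : A) : b != c -> val b - val c \in E.
    by move=> bc; apply: sub_nonzero_diffset (fsvalP b) (fsvalP c) bc.
  have zxE : val x - val z \in E by apply: D; rewrite eq_sym.
  rewrite /pinned_ratio /=; apply/andP; split.
    apply/imfset2P; exists (a * (val x - val y)) => /=; last first.
      by exists (val x - val z) => //; rewrite mulrA.
    by apply/prodsetM/mem_prodset1/D => //; rewrite eq_sym.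
  apply/imfset2P; exists (a * (val y - val z)) => /=.
    by apply/prodsetM/mem_prodset1/D => //; rewrite eq_sym.
  by exists (val x - val z) => //; apply: ratioB; apply: nzE.
have U0 : 0 \notin U.
  apply/negP => /imfsetP[[[x y] z] /=]; rewrite !inE !andbT /= => /and3P[yx zy zx] /esym/eqP.
  rewrite /pinned_ratio /= mulf_eq0 invr_eq0 !subr_eq0 !val_eqE.
  by rewrite eq_sym (negbTE yx) eq_sym (negbTE zx).
have main := card_unit_equation (prodset_notin0 k E0) U0 PUY.
have tri : (#|` P| * #|` Y| <= #|` prodset k.*2.+1 E| * #|` prodset (k + 1) E|)%N.
  apply: ruzsa_triangle (prodset_notin0 k E0) E0 _ _.
    move=> p q pP qQ; have -> : (k.*2.+1 = k + 1 + k)%N by lia.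
    exact: prodsetM.
  by move=> p e pP eE; rewrite mulrC; apply/prodsetM/mem_prodset1.
have mono : (#|` prodset (k + 1) E| <= #|` prodset k.*2.+1 E|)%N.
  by rewrite (leq_card_prodset (nzE _ dE) dE) //; lia.
have YK : #|` Y|%:R <= K ^+ 2 * #|` P|%:R :> R.
  rewrite -(ler_pM2l p0) -natrM; apply: le_trans (_ : #|` prodset k.*2.+1 E|%:R ^+ 2 <= _).
    by rewrite -natrX ler_nat; apply: leq_trans tri _; rewrite -mulnn leq_mul.
  have -> : #|` P|%:R * (K ^+ 2 * #|` P|%:R) = (K * #|` P|%:R) ^+ 2 by ring.
  by rewrite lerXn2r ?nnegrE ?mulr_ge0.
have Y4 : #|` Y|%:R ^+ 4 <= (K ^+ 2 * #|` P|%:R) ^+ 4 :> R.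
  by rewrite lerXn2r ?nnegrE ?mulr_ge0 ?exprn_ge0.
rewrite -(ler_nat R) natrM natrX natrX natrM natrX in main.
rewrite -(ler_pM2l (exprn_gt0 2 p0)).
have -> : #|` P|%:R ^+ 2 * (512 * K ^+ 8 * #|` P|%:R ^+ 2) = 512 * (K ^+ 2 * #|` P|%:R) ^+ 4 by ring.
by apply: le_trans main _; rewrite ler_wpM2l.
Qed.

(* The side condition only discards the meaningless expressions 0^(3 - eps)
   with 3 - eps <= 0: for empty A and eps < 3 both sides are 0.
   The function powR, written x `^ y, is the real power. *)
Theorem theorem1p2 (R : realType) (eps : R) (eps_gt0 : 0 < eps) :
  exists k : nat, exists c : R,
    [/\ (0 < k)%N, 0 < c &
      forall A : {fset R}, eps < 3 \/ A != fset0 ->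
        c * (#|` A|%:R `^ (3 - eps)) <= #|` prodset k (diffset A)|%:R].
Proof.
(* The losses are n^(3d) from the logarithm and K^8 = n^(8d) from the growth:
   11 d in the exponent of a squared estimate. *)
pose d := 2 * eps / 11.
have d0 : 0 < d by rewrite /d; lra.
pose J := (Num.bound (3 / d)).+1.
have Jd : 3 <= d * J%:R.
  rewrite mulrC -ler_pdivrMr //; apply/ltW.
  have := @archi_boundP R (3 / d) (divr_ge0 (ler0n _ 3) (ltW d0)) => /lt_le_trans; apply.
  by rewrite ler_nat.
(* kk j = 2^j - 1; the first product set, with no factor, is the singleton 1. *)
pose kk j := iter j (fun k => k.*2.+1) 0%N.
have kk_mono j j' : (j <= j')%N -> (kk j <= kk j')%N.
  move=> /subnK <-; elim: (j' - j)%N => // i; rewrite addSn /=; lia.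
pose M := 1944 ^+ 3 * 512 * (1 + d^-1) ^+ 3 : R.
have h1 : 1 <= (1 + d^-1) ^+ 3 by rewrite exprn_ege1 // lerDl invr_ge0 ltW.
have M64 : 64 <= M by rewrite /M; lra.
have M0 : 0 < M by lra.
pose s := Num.sqrt M.
have s2 : s ^+ 2 = M by rewrite sqr_sqrtr // ltW.
have s0 : 0 < s by rewrite sqrtr_gt0.
have s8 : 8 <= s by rewrite -(@ler_pXn2r _ 2) ?nnegrE ?(ltW s0) // s2; lra.
exists (kk J), s^-1; split; [by []|by rewrite invr_gt0|].
move=> A hA; rewrite mulrC ler_pdivrMr //.
set n := #|` A|.
have [n0|n0] := posnP n.
  have A0 : A = fset0 by apply: cardfs0_eq.
  case: hA => [e3|]; last by rewrite A0 eqxx.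
  by rewrite n0 powR0 ?subr_eq0 ?gt_eqF // mulr_ge0 // ltW.
have n1 : 1 <= n%:R :> R by rewrite ler1n.
have le_cube : n%:R `^ (3 - eps) <= n%:R ^+ 3.
  by rewrite -powR_mulrn //; apply: ler_powR => //; lra.
have full_gt0 : 1 <= #|` prodset (kk J) (diffset A)|%:R :> R.
  rewrite ler1n; have [a aA] : exists a, a \in A by apply/fset0Pn; rewrite -cardfs_gt0.
  by apply: (@card_prodset_gt0 _ _ _ (a - a)); apply/imfset2P; exists a => //; exists a.
(* With at most two elements there are no ratios, and n^3 <= 8 <= s. *)
have [n2|n2] := leqP n 2.
  apply: le_trans le_cube _; apply: le_trans (_ : 8 <= _).
    by rewrite -natrX ler_nat (@leq_exp2r _ 2 3).
  by apply: le_trans s8 _; rewrite ler_peMl // ltW.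
pose E := nonzero_diffset A.
pose f j : R := #|` prodset (kk j) E|%:R.
have [e eE] : exists e, e \in E by exact/exists_nonzero_diff/ltnW.
have e0 : e != 0 by move: eE; rewrite !inE => /andP[].
have f_le j : (j <= J)%N -> f j <= #|` prodset (kk J) (diffset A)|%:R.
  move=> jJ; rewrite ler_nat; apply: leq_trans (leq_card_prodset e0 eE (kk_mono _ _ jJ)) _.
  by apply/fsubset_leq_card/prodsetS; apply: fsubD1set.
have K0 : 0 <= n%:R `^ d by apply: powR_ge0.
have f0 : 1 <= f 0%N by rewrite ler1n; apply: card_prodset_gt0 eE.
case: (slow_step_or_geometric J K0 f0) => [[j jJ slow]|big]; last first.
  apply: le_trans le_cube _; apply: le_trans (_ : f J <= _).
    apply: le_trans big; rewrite -!powR_mulrn ?powR_ge0 // -powRrM.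
    exact: ler_powR.
  apply: le_trans (f_le _ (leqnn J)) _; rewrite ler_peMr //; lra.
apply: le_trans (_ : f j * s <= _); last by rewrite ler_wpM2r ?(ltW s0) // f_le // ltnW.
have N3 := slow_growth_bound n2 K0 slow.
have N2 := card_pinned_ratios_powR d0 n2.
rewrite -/(f j) -/n in N2 N3.
set N := #|` pinned_ratios A|%:R in N2 N3.
set K := n%:R `^ d in K0 N2 N3.
have Kp : 0 < K by rewrite powR_gt0 // ltr0n.
rewrite -(@ler_pXn2r _ 2) ?nnegrE ?powR_ge0 ?mulr_ge0 ?(ltW s0) // exprMn s2.
have -> : (n%:R `^ (3 - eps)) ^+ 2 = n%:R ^+ 6 / K ^+ 11.
  rewrite -!powR_mulrn ?powR_ge0 // -!powRrM -powRB ?pnatr_eq0 -?lt0n ?n0 ?implybT //.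
  by congr (_ `^ _); rewrite /d; field.
rewrite ler_pdivrMr ?exprn_gt0 //.
have n6 : (n%:R ^+ 2) ^+ 3 <= (1944 * (1 + d^-1) * K * N) ^+ 3.
  by rewrite lerXn2r ?nnegrE ?exprn_ge0 ?mulr_ge0 // ?addr_ge0 ?invr_ge0 // ltW.
rewrite -exprM in n6; apply: le_trans n6 _.
have -> : (1944 * (1 + d^-1) * K * N) ^+ 3 = 1944 ^+ 3 * (1 + d^-1) ^+ 3 * K ^+ 3 * N ^+ 3 by ring.
have -> : f j ^+ 2 * M * K ^+ 11 = 1944 ^+ 3 * (1 + d^-1) ^+ 3 * K ^+ 3 * (512 * K ^+ 8 * f j ^+ 2).
  by rewrite /M; ring.
by rewrite ler_wpM2l // !mulr_ge0 // ?exprn_ge0 ?addr_ge0 ?invr_ge0 ?(ltW d0) ?ler0n ?ler01.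
Qed.
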